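(* For $n\geq 0$, $F_n^M(x,y,q)=F_n(x,y,q)$.
   Context: Permutations: $S_n(123,132,213)$ is the set of permutations of $[n]$ with no subsequence order isomorphic to $123$, $132$ or $213$; each such $\pi$ is a concatenation of increasing blocks of size $1$ or $2$, each block larger than all later blocks; $s(\pi)$, $d(\pi)$ are the numbers of maximal increasing runs of $\pi$ of length $1$ and $2$; $maj(\pi)=\sum_{i:\,p_i>p_{i+1}}i$; $F_n^M(x,y,q)=\sum_{\pi\in S_n(123,132,213)}x^{s(\pi)}y^{d(\pi)}q^{maj(\pi)}$. Set partitions: a partition of $[n]$ is written $B_1/B_2/\dots/B_k$ with $\min B_1<\dots<\min B_k$. For $\alpha=A_1/\dots/A_k\vdash[m]$ and $\beta=B_1/\dots/B_\ell\vdash[n]$, $\beta$ contains the pattern $\alpha$ if there are distinct blocks $B_{i_1},\dots,B_{i_k}$ of $\beta$ and subsets $A'_j\subseteq B_{i_j}$ such that the partition $A'_1/\dots/A'_k$ of $\bigcup_j A'_j$ is carried to $\alpha$ by the unique order-preserving bijection $\bigcup_j A'_j\to[m]$; otherwise $\beta$ avoids $\alpha$. $\Pi_n(13/2,123)$ is the set of partitions of $[n]$ avoiding both $13/2$ and $123$. For $\alpha=B_1/\dots/B_k$, a right bigger pair is a pair $(b,B_j)$ with $b\in B_i$, $j>i$ and $\max B_j>b$; $rb(\alpha)$ is the number of right bigger pairs. $s(\alpha)$, $d(\alpha)$ are the numbers of blocks of size $1$ and $2$. $F_n(x,y,q)=\sum_{\alpha\in\Pi_n(13/2,123)}x^{s(\alpha)}y^{d(\alpha)}q^{rb(\alpha)}$.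 *)

(* Defs.v *)
From HB Require Import structures.
From mathcomp Require Import all_boot all_order all_fingroup all_algebra.
From mathcomp Require Import mpoly.

Set Implicit Arguments.
Unset Strict Implicit.
Unset Printing Implicit Defensive.

Import GRing.Theory.

(* The polynomials F_n and F_n^M live in Z[x, y, q]. *)
Definition vx : {mpoly int[3]} := mpolyX int U_(@Ordinal 3 0 isT)%MM.
Definition vy : {mpoly int[3]} := mpolyX int U_(@Ordinal 3 1 isT)%MM.
Definition vq : {mpoly int[3]} := mpolyX int U_(@Ordinal 3 2 isT)%MM.

(* A permutation of [n] = {1, ..., n} is a permutation of 'I_n, the ordinal i
   standing for i + 1; [perm_word] is its one-line notation p_1 ... p_n. *)
Definition perm_word (n : nat) (pi : 'S_n) : seq nat :=
  [seq (pi i).+1 | i <- enum 'I_n].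

Definition order_iso (s t : seq nat) : bool :=
  (size s == size t) &&
  [forall i : 'I_(size s), forall j : 'I_(size s),
     (nth 0 s i < nth 0 s j) == (nth 0 t i < nth 0 t j)].

Definition word_contains (p w : seq nat) : bool :=
  [exists m : (size w).-tuple bool, order_iso (mask m w) p].

Definition perm_avoiders (n : nat) : {set 'S_n} :=
  [set pi : 'S_n |
    [&& ~~ word_contains [:: 1; 2; 3] (perm_word pi),
        ~~ word_contains [:: 1; 3; 2] (perm_word pi)
      & ~~ word_contains [:: 2; 1; 3] (perm_word pi)]].

(* The k consecutive letters of w starting at (0-based) position i increase,
   and can be extended neither to the left nor to the right. *)
Definition is_max_run (w : seq nat) (k i : nat) : bool :=
  [&& i + k <= size w,
      sorted ltn (take k (drop i w)),
      (i == 0) || (nth 0 w i <= nth 0 w i.-1)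
    & (i + k == size w) || (nth 0 w (i + k) <= nth 0 w (i + k).-1)].

Definition num_runs (k : nat) (w : seq nat) : nat :=
  count (is_max_run w k) (iota 0 (size w)).

(* Here i is the 1-based position of p_i, whence the shift in [nth]. *)
Definition maj (w : seq nat) : nat :=
  \sum_(1 <= i < size w | nth 0 w i < nth 0 w i.-1) i.

Definition FM (n : nat) : {mpoly int[3]} :=
  (\sum_(pi in perm_avoiders n)
     vx ^+ num_runs 1 (perm_word pi) * vy ^+ num_runs 2 (perm_word pi)
     * vq ^+ maj (perm_word pi))%R.

(* A set partition of [n] is a set P of sets with [partition P [set: 'I_n]],
   the ordinal i again standing for i + 1.
   The strictly increasing map f is the inverse of the standardization
   bijection, its image is the union of the A'_j, and g sends each block A_j
   of alpha to the block B_(i_j), so that A'_j = f @: A_j. *)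
Definition part_contains (m n : nat)
    (alpha : {set {set 'I_m}}) (beta : {set {set 'I_n}}) : bool :=
  [exists f : {ffun 'I_m -> 'I_n},
   exists g : {ffun {set 'I_m} -> {set 'I_n}},
    [&& [forall i : 'I_m, forall j : 'I_m, (i < j) ==> (f i < f j)],
        [forall A in alpha, g A \in beta],
        dinjectiveb g (mem alpha)
      & [forall A in alpha, (f @: (A : {set 'I_m})) \subset g A]]].

Definition part13_2 : {set {set 'I_3}} :=
  [set [set inord 0; inord 2]; [set inord 1]].

Definition part123 : {set {set 'I_3}} :=
  [set [set inord 0; inord 1; inord 2]].

Definition part_avoiders (n : nat) : {set {set {set 'I_n}}} :=
  [set P : {set {set 'I_n}} |
    [&& partition P [set: 'I_n],
        ~~ part_contains part13_2 P & ~~ part_contains part123 P]].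

(* Only used on nonempty B; n is then a neutral upper bound. *)
Definition block_min (n : nat) (B : {set 'I_n}) : nat :=
  \big[minn/n]_(i in B) i.

Definition block_max (n : nat) (B : {set 'I_n}) : nat := \max_(i in B) i.

(* Blocks are numbered by increasing minimum, so j > i for the indices of two
   blocks means that the minimum of B_j exceeds that of B_i = pblock P b. *)
Definition rb (n : nat) (P : {set {set 'I_n}}) : nat :=
  #|[set bB : 'I_n * {set 'I_n} |
      [&& bB.2 \in P,
          block_min (pblock P bB.1) < block_min bB.2
        & bB.1 < block_max bB.2]]|.

Definition num_blocks (n k : nat) (P : {set {set 'I_n}}) : nat :=
  #|[set B in P | #|B| == k]|.

Definition FP (n : nat) : {mpoly int[3]} :=
  (\sum_(P in part_avoiders n)
     vx ^+ num_blocks 1 P * vy ^+ num_blocks 2 P * vq ^+ rb P)%R.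

(* Main.v *)
(* Reversing the values of a permutation, s(i) = n + 1 - pi(i), turns the
   avoiders of 123, 132, 213 into the permutations s with |s(i) - i| <= 1: all
   three patterns have a non-inversion between their outer letters, and any
   non-inversion of pi at non-adjacent positions extends to one of them. Such an
   s is an involution exchanging disjoint pairs {i, i + 1}. On the other side, a
   partition avoids 13/2 and 123 exactly when two elements of a block differ by
   at most 1. So sending pi to the partition with blocks {i, s(i)} is a
   bijection; runs of length 1 and 2 become blocks of size 1 and 2, and both maj
   and rb are the sum of min B - 1 over all blocks B. *)
Require Import Defs.
From mathcomp Require Import all_boot all_order all_fingroup all_algebra.
From mathcomp Require Import mpoly zify.

Set Implicit Arguments.
Unset Strict Implicit.
Unset Printing Implicit Defensive.

(** * Injections of an initial segment that move every point by at most 1 *)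

Definition near_id (n : nat) (s : 'I_n -> 'I_n) : Prop :=
  forall i : 'I_n, i <= (s i).+1 /\ s i <= i.+1.

(** A step down not undone at once forces another step down, and by induction from 0 the latter is
    undone, against injectivity. A step up is handled through the preimage of [i]: were it [i - 1],
    induction would send [i] back down. *)
Lemma near_id_involutive (n : nat) (s : 'I_n -> 'I_n) :
  injective s -> near_id s -> involutive s.
Proof.
move=> s_inj s_near.
have down m : forall i : 'I_n, i = m :> nat -> s i = i.-1 :> nat -> s (s i) = i.
  elim: m => [|m IHm] i im si.
    have E : s i = i by apply: val_inj => /=; lia.
    by rewrite !E.
  have [_ ssi] := s_near (s i); have [ssi' _] := s_near (s i).
  have [E|[E|E]] : s (s i) = i :> nat \/ s (s i) = s i :> nat \/
                     s (s i) = (s i).-1 :> nat by lia.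
  - exact: val_inj.
  - by have := s_inj _ _ (val_inj E) => /(congr1 val) /=; lia.
  - have := IHm (s i) ltac:(rewrite /=; lia) E => /(s_inj _ _) /(congr1 val) /=; lia.
have up m : forall i : 'I_n, i = m :> nat -> s i = i.+1 :> nat -> s (s i) = i.
  elim/ltn_ind: m => m IHm i im si.
  have [j ji] : exists j, s j = i.
    have /codomP[j ->] := inj_card_onto s_inj (leqnn _) i; by exists j.
  have sj := s_near j; rewrite ji in sj.
  have [E|[E|E]] : j = i.+1 :> nat \/ j = i :> nat \/ i = j.+1 :> nat by lia.
  - by rewrite -[RHS]ji; congr (s _); apply: val_inj; rewrite /= si.
  - by move: ji; rewrite (val_inj E) => /(congr1 val) /=; lia.
  - have := IHm j ltac:(lia) j erefl.
    rewrite ji => /(_ E) /(congr1 val) /=; lia.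
move=> i; have [si si'] := s_near i.
have [E|[E|E]] : s i = i.+1 :> nat \/ s i = i :> nat \/ s i = i.-1 :> nat by lia.
- exact: (up i).
- by rewrite !(val_inj E).
- exact: (down i).
Qed.

Lemma card_ord_lt (n m : nat) : m <= n -> #|[set k : 'I_n | k < m]| = m.
Proof.
move=> le_mn; rewrite -sum1dep_card -(big_ord_widen n (fun=> 1)) //.
by rewrite sum1_card card_ord.
Qed.

Lemma inj_leq_bound (n m1 m2 : nat) (s : 'I_n -> 'I_n) : injective s ->
  m1 <= n -> m2 <= n -> (forall k : 'I_n, k < m1 -> s k < m2) -> m1 <= m2.
Proof.
move=> s_inj le_m1 le_m2 s12; rewrite -(card_ord_lt le_m1) -(card_ord_lt le_m2).
rewrite -(card_imset _ s_inj); apply/subset_leq_card/subsetP=> _ /imsetP[k + ->].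
by rewrite !inE; apply: s12.
Qed.

Lemma near_idP (n : nat) (s : 'I_n -> 'I_n) : injective s ->
  near_id s <-> (forall i j : 'I_n, i < j -> s j < s i -> j = i.+1 :> nat).
Proof.
move=> s_inj; split=> [s_near i j ij sji|s_inv i].
  by have [_ ?] := s_near i; have [? _] := s_near j; lia.
have lt_i := ltn_ord i; split.
  (* Positions [k < i.-1] are not adjacent to [i], so their values lie below [s i], and there are
     [i.-1] of them. *)
  have : i.-1 <= s i; last by lia.
  apply: (inj_leq_bound s_inj) => [||k lt_k]; [lia | exact: ltnW |].
  case: (ltngtP (s k) (s i)) => // [lt_s|/val_inj/s_inj eq_ki].
    by have := s_inv k i; lia.
  by move: lt_k; rewrite eq_ki; lia.
have [lt_i2|] := leqP i.+2 n; last by have := ltn_ord (s i); lia.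
(* Dual count through the inverse of [s]: the values up to [s i] all sit at positions up to
   [i.+1]. *)
have : (s i).+1 <= i.+2; last by [].
apply: (@inj_leq_bound n _ _ (invF s_inj)) => // [|k le_k].
  exact: can_inj (f_invF s_inj).
move: le_k; rewrite -{1}(f_invF s_inj k); set j := invF s_inj k => le_j.
have [//|lt_ij] := leqP j i; first by lia.
have [/val_inj/s_inj eq_ji|ne_s] := eqVneq (val (s j)) (val (s i)).
  by move: lt_ij; rewrite eq_ji ltnn.
have := s_inv i j lt_ij; move: ne_s => /=; lia.
Qed.

(** * Pattern containment in words and the avoiding permutations *)

(** Masking [w] amounts to masking the list of its positions and then reading the letters, which
    trades bit masks for increasing lists of positions. *)
Lemma word_containsP (p w : seq nat) :
  reflect (exists t : seq nat, [/\ sorted ltn t, all (gtn (size w)) t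
                                 & order_iso (map (nth 0 w) t) p])
          (word_contains p w).
Proof.
have mask_nth m : mask m w = map (nth 0 w) (mask m (iota 0 (size w))).
  by rewrite map_mask -/(mkseq _ _) mkseq_nth.
apply: (iffP existsP) => [[m]|[t [t_sorted t_lt iso_t]]].
  rewrite mask_nth => iso_m; exists (mask m (iota 0 (size w))); split=> //.
    exact: (sorted_mask ltn_trans) (iota_ltn_sorted _ _).
  by apply/allP=> i /mem_mask; rewrite mem_iota.
have t_iota : subseq t (iota 0 (size w)).
  have -> : t = [seq i <- iota 0 (size w) | i \in t].
    apply: (irr_sorted_eq ltn_trans ltnn) => // [|i].
      by apply: sorted_filter (iota_ltn_sorted _ _); apply: ltn_trans.
    rewrite mem_filter mem_iota andb_idr // => ti.
    exact: (allP t_lt).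
  exact: filter_subseq.
have /subseqP[m sz_m def_t] := t_iota; rewrite size_iota in sz_m.
by exists (tcast sz_m (in_tuple m)); rewrite val_tcast mask_nth -def_t.
Qed.

(** Quantifying over [iota] lets the test on concrete patterns simplify to comparisons that [lia]
    decides. *)
Lemma order_isoE (s t : seq nat) : order_iso s t =
  (size s == size t) &&
  all (fun i => all (fun j => (nth 0 s i < nth 0 s j) == (nth 0 t i < nth 0 t j))
                    (iota 0 (size s))) (iota 0 (size s)).
Proof.
rewrite /order_iso; congr (_ && _).
apply/forallP/allP => iso i.
  rewrite mem_iota => lt_i; apply/allP=> j; rewrite mem_iota => lt_j.
  exact: (forallP (iso (Ordinal lt_i)) (Ordinal lt_j)).
have in_iota (k : 'I_(size s)) : val k \in iota 0 (size s) by rewrite mem_iota ltn_ord.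
by apply/forallP=> j; apply: (allP (iso _ (in_iota i)) _ (in_iota j)).
Qed.

Lemma word_contains3P (a b c : nat) (w : seq nat) :
  reflect (exists i j k, [/\ i < j < k, k < size w
              & order_iso [:: nth 0 w i; nth 0 w j; nth 0 w k] [:: a; b; c]])
          (word_contains [:: a; b; c] w).
Proof.
apply: (iffP (word_containsP _ _)) => [[t [t_sorted t_lt iso_t]]|].
  have /andP[/eqP] := iso_t; rewrite size_map.
  case: t t_sorted t_lt iso_t => [|i [|j [|k []]]] //= /and3P[ij jk _].
  case/and4P=> _ _ lt_k _ iso_t _; exists i, j, k.
  by split; rewrite ?ij.
case=> i [j [k [/andP[ij jk] lt_k iso_w]]]; exists [:: i; j; k].
split; rewrite //= ?ij ?jk //= andbT lt_k.
by rewrite (ltn_trans (ltn_trans ij jk)) ?(ltn_trans jk).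
Qed.

Lemma size_perm_word (n : nat) (pi : 'S_n) : size (perm_word pi) = n.
Proof. by rewrite size_map size_enum_ord. Qed.

Lemma nth_perm_word (n : nat) (pi : 'S_n) (i : 'I_n) :
  nth 0 (perm_word pi) i = (pi i).+1.
Proof. by rewrite (nth_map i) ?size_enum_ord ?nth_ord_enum. Qed.

Definition flip (n : nat) (pi : 'S_n) (i : 'I_n) : 'I_n := rev_ord (pi i).

Lemma flip_inj (n : nat) (pi : 'S_n) : injective (flip pi).
Proof. exact: inj_comp rev_ord_inj perm_inj. Qed.

Lemma flip_lt (n : nat) (pi : 'S_n) (i j : 'I_n) :
  (flip pi j < flip pi i) = (pi i < pi j).
Proof. by rewrite /flip /=; have := ltn_ord (pi i); have := ltn_ord (pi j); lia. Qed.

Lemma perm_avoidersP (n : nat) (pi : 'S_n) :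
  reflect (near_id (flip pi)) (pi \in perm_avoiders n).
Proof.
rewrite inE; apply: (iffP idP) => [|/(near_idP (@flip_inj n pi)) near].
  case/and3P=> no123 no132 no213; apply/(near_idP (@flip_inj n pi)) => i j ij.
  rewrite flip_lt => pij; apply/eqP; apply: contraT => ne_j.
  have lt_in : i.+1 < n by have := ltn_ord j; lia.
  (* The position right after [i] lies strictly before [j]. Its value completes a 213 if below
     [pi i], a 123 if between [pi i] and [pi j], and a 132 if above [pi j]. *)
  pose k := Ordinal lt_in.
  have contains p : order_iso [:: (pi i).+1; (pi k).+1; (pi j).+1] p ->
      word_contains p (perm_word pi).
    move=> iso; apply/word_containsP; exists [:: val i; val k; val j].
    rewrite /= !nth_perm_word (nth_perm_word pi k) size_perm_word !ltn_ord.
    by split=> //; lia.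
  have ne_ki : pi k != pi i :> nat.
    by rewrite (inj_eq val_inj) (inj_eq perm_inj) -val_eqE /=; lia.
  have ne_kj : pi k != pi j :> nat.
    by rewrite (inj_eq val_inj) (inj_eq perm_inj) -val_eqE /=; lia.
  have [lt_ki|] := ltnP (pi k) (pi i).
    by case/negP: no213; apply: contains; rewrite order_isoE /=; lia.
  have [lt_kj|] := ltnP (pi k) (pi j) => *.
    by case/negP: no123; apply: contains; rewrite order_isoE /=; lia.
  by case/negP: no132; apply: contains; rewrite order_isoE /=; lia.
(* The outer letters of an occurrence would give an inversion of [flip pi] at positions at least 2
   apart. *)
have avoid a b c : a < c -> ~~ word_contains [:: a; b; c] (perm_word pi).
  move=> lt_ac; apply/word_contains3P => -[i [j [k [ijk]]]].
  rewrite size_perm_word => lt_k.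
  have lt_i : i < n by lia.
  rewrite order_isoE /= -[i]/(val (Ordinal lt_i)) -[k]/(val (Ordinal lt_k)).
  rewrite !nth_perm_word => iso.
  have := near (Ordinal lt_i) (Ordinal lt_k); rewrite flip_lt /=; lia.
by rewrite !avoid.
Qed.

(** * Runs and major index in terms of an involution [s] that reverses the order of the values of
    [pi] *)

Section RunStatistics.

Variables (n : nat) (pi : 'S_n) (s : 'I_n -> 'I_n).
Hypothesis s_inj : injective s.
Hypothesis s_near : near_id s.
Hypothesis s_lt : forall i j, (s j < s i) = (pi i < pi j).
Local Notation w := (perm_word pi).

Let sK : involutive s := near_id_involutive s_inj s_near.

(** An ascent of [pi] is a descent of [s], and i <= s(i+1) < s(i) <= i+1 leaves only the exchange of
    i and i+1. *)
Lemma ascent_after (i : 'I_n) : i.+1 < n ->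
  (nth 0 w i < nth 0 w i.+1) = (s i == i.+1 :> nat).
Proof.
move=> lt_in; pose j := Ordinal lt_in.
rewrite -[i.+1 in LHS]/(val j) !nth_perm_word ltnS -s_lt.
apply/idP/eqP => [lt_s|si].
  by have [_ +] := s_near i; have [+ _] := s_near j; rewrite [val j]/=; lia.
have -> : j = s i by apply: val_inj; rewrite /= si.
by rewrite sK; lia.
Qed.

Lemma ascent_before (i : 'I_n) : 0 < i ->
  (nth 0 w i.-1 < nth 0 w i) = (s i < i).
Proof.
move=> i_gt0; have lt_j : i.-1 < n by have := ltn_ord i; lia.
pose j := Ordinal lt_j; have ji : (val j).+1 = i by rewrite /= prednK.
have := @ascent_after j; rewrite ji => -> //; have [si _] := s_near i.
apply/eqP/idP => [/val_inj sj|lt_s]; first by rewrite -sj sK sj -ji.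
have -> : j = s i by apply: val_inj; move: ji => /=; lia.
by rewrite sK.
Qed.

Lemma descent_before (i : 'I_n) : 0 < i ->
  (nth 0 w i < nth 0 w i.-1) = (i <= s i).
Proof.
move=> i_gt0; rewrite [RHS]leqNgt -ascent_before // -leqNgt [RHS]leq_eqVlt.
have lt_j : i.-1 < n by have := ltn_ord i; lia.
rewrite -[i.-1]/(val (Ordinal lt_j)) !nth_perm_word.
rewrite eqSS val_eqE (inj_eq perm_inj) -val_eqE /=.
by have -> : (i == i.-1 :> nat) = false by lia.
Qed.

Lemma num_runsE (k : nat) : num_runs k w = #|[set i : 'I_n | is_max_run w k i]|.
Proof.
rewrite /num_runs size_perm_word -val_enum_ord count_map -sum1_count.
by rewrite big_enum_cond /= sum1dep_card.
Qed.

Lemma max_run1 (i : 'I_n) : is_max_run w 1 i = (s i == i).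
Proof.
rewrite /is_max_run size_perm_word addn1 ltn_ord /=.
have -> : sorted ltn (take 1 (drop i w)) by case: drop => [|? []].
have lt_si := ltn_ord (s i); rewrite -val_eqE /=.
(* At an end of the word a neighbour is missing; the range of [s] then rules out the corresponding
   value of [s i]. *)
have [i0|i_gt0] := posnP i; have [i1|lt_in] := eqVneq i.+1 n => /=.
- by lia.
- rewrite leqNgt ascent_after //; last by have := ltn_ord i; lia.
  by have [] := s_near i; rewrite /=; lia.
- by rewrite leqNgt ascent_before //=; move: lt_si => /=; lia.
- rewrite [X in X && _]leqNgt ascent_before // [X in _ && X]leqNgt ascent_after;
    last by have := ltn_ord i; lia.
  by have [] := s_near i; rewrite /=; lia.
Qed.

Lemma max_run2 (i : 'I_n) : is_max_run w 2 i = (s i == i.+1 :> nat).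
Proof.
rewrite /is_max_run size_perm_word addn2.
have [lt_in|le_ni] := leqP i.+2 n; last first.
  by have := ltn_ord (s i); case: eqP => //; lia.
rewrite (drop_nth 0) ?size_perm_word // (drop_nth 0) ?size_perm_word //.
rewrite /= take0 /= andbT ascent_after //.
case: eqP => //= si.
have sj : s (Ordinal lt_in) = i by rewrite -[RHS]sK; congr s; apply: val_inj.
(* Maximality is automatic: [s i] exceeds [i], so no ascent precedes the pair, and s(i+1) = i, so
   none follows it. *)
apply/andP; split.
  have [//|i_gt0] := posnP i.
  by rewrite leqNgt ascent_before // si; lia.
have [//|lt_in2] := eqVneq i.+2 n => /=.
rewrite leqNgt (@ascent_after (Ordinal lt_in)) /=; last by lia.
by rewrite sj; lia.
Qed.

Lemma num_runs1 : num_runs 1 w = #|[set i : 'I_n | s i == i]|.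
Proof. by rewrite num_runsE; apply: eq_card => i; rewrite !inE max_run1. Qed.

Lemma num_runs2 : num_runs 2 w = #|[set i : 'I_n | s i == i.+1 :> nat]|.
Proof. by rewrite num_runsE; apply: eq_card => i; rewrite !inE max_run2. Qed.

(** The 1-based position of a descent is the 0-based index of the letter after it. The index 0
    satisfies [i <= s i] without being a descent, but contributes 0. *)
Lemma majE : maj w = \sum_(i : 'I_n | i <= s i) i.
Proof.
rewrite /maj size_perm_word big_mkcond /= [RHS]big_mkcond /=.
transitivity (\sum_(0 <= i < n) if nth 0 w i < nth 0 w i.-1 then i else 0).
  case: (posnP n) => [n0|n_gt0]; first by rewrite !big_geq ?n0.
  by rewrite [RHS]big_ltn //; case: ifP.
rewrite big_mkord; apply: eq_bigr => i _.
have [->|i_gt0] := posnP i; first by rewrite !if_same.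
by rewrite descent_before.
Qed.

End RunStatistics.

(** * The avoiding partitions and block minima *)

(** Treats both patterns at once: each has a block holding 1 and 3, and the image of 2 separates
    their images. *)
Lemma part_contains_spread (n : nat) (alpha : {set {set 'I_3}}) (A : {set 'I_3})
    (P : {set {set 'I_n}}) :
  A \in alpha -> inord 0 \in A -> inord 2 \in A -> part_contains alpha P ->
  exists2 B : {set 'I_n}, B \in P &
    exists a b : 'I_n, [/\ a \in B, b \in B & a.+1 < b].
Proof.
move=> Aalpha A0 A2 /existsP[f /existsP[g /and4P[/forallP f_mono gP _ fg]]].
have gA := forall_inP gP A Aalpha; have /subsetP fA := forall_inP fg A Aalpha.
exists (g A) => //; exists (f (inord 0)), (f (inord 2)).
rewrite !fA ?imset_f //; split=> //.
have f01 := implyP (forallP (f_mono (inord 0)) (inord 1)).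
have f12 := implyP (forallP (f_mono (inord 1)) (inord 2)).
rewrite !inordK // in f01 f12.
exact: leq_ltn_trans (f01 isT) (f12 isT).
Qed.

Lemma part_avoidersP (n : nat) (P : {set {set 'I_n}}) :
  reflect (partition P [set: 'I_n] /\
           forall (B : {set 'I_n}) (a b : 'I_n),
             B \in P -> a \in B -> b \in B -> b <= a.+1)
          (P \in part_avoiders n).
Proof.
rewrite inE; apply: (iffP and3P) => [[partP no132 no123]|[partP near]]; last first.
  have no_spread (alpha : {set {set 'I_3}}) (A : {set 'I_3}) :
      A \in alpha -> inord 0 \in A -> inord 2 \in A -> ~~ part_contains alpha P.
    move=> Aalpha A0 A2; apply/negP.
    case/(part_contains_spread Aalpha A0 A2) => B BP [a [b [aB bB]]].
    by rewrite ltnNge (near B).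
  split=> //.
    by apply: (no_spread _ [set inord 0; inord 2]); rewrite !inE eqxx ?orbT.
  by apply: (no_spread _ [set inord 0; inord 1; inord 2]); rewrite !inE eqxx ?orbT.
split=> // B a b BP aB bB; rewrite leqNgt; apply/negP => lt_ab.
have lt_cn : a.+1 < n by apply: ltn_trans (ltn_ord b).
(* The successor of [a] lies strictly between [a] and [b]: inside [B] it completes a copy of 123, in
   another block a copy of 13/2. *)
pose c := Ordinal lt_cn.
pose f := [ffun i : 'I_3 => nth a [:: a; c; b] i].
have f_mono : [forall i : 'I_3, forall j : 'I_3, (i < j) ==> (f i < f j)].
  apply/forallP=> -[[|[|[|i]]] lt_i] //; apply/forallP=> -[[|[|[|j]]] lt_j] //;
    by rewrite !ffunE //=; lia.
have fE : (f (inord 0) = a) * (f (inord 1) = c) * (f (inord 2) = b).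
  by rewrite !ffunE !inordK.
have triP : trivIset P by case/and3P: partP.
have [cB|cB] := boolP (c \in B).
  case/negP: no123; apply/existsP; exists f; apply/existsP; exists [ffun => B].
  apply/and4P; split=> //.
  - by apply/forall_inP=> A _; rewrite ffunE.
  - by apply/dinjectiveP=> A A' /set1P-> /set1P->.
  - apply/forall_inP=> A /set1P->; rewrite ffunE; apply/subsetP=> _ /imsetP[i + ->].
    by rewrite !inE => /orP[/orP[]|] /eqP->; rewrite fE.
have [partT _ _] := and3P partP.
have cP : c \in cover P by rewrite (eqP partT) inE.
case/negP: no132; apply/existsP; exists f; apply/existsP.
(* Membership of the middle element tells the two blocks of 13/2 apart. *)
exists [ffun A : {set 'I_3} => if inord 1 \in A then pblock P c else B].
have in02 : (inord 1 : 'I_3) \in [set inord 0; inord 2] = false.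
  by rewrite !inE -!val_eqE /= !inordK.
have in1 : (inord 1 : 'I_3) \in [set inord 1] by rewrite inE.
have neB : B <> pblock P c by move=> eqB; case/negP: cB; rewrite eqB mem_pblock.
apply/and4P; split=> //.
- by apply/forall_inP=> A _; rewrite ffunE; case: ifP => // _; apply: pblock_mem.
- apply/dinjectiveP=> A A' /set2P[]-> /set2P[]->; rewrite !ffunE ?in02 ?in1 //.
  by move=> /esym.
- apply/forall_inP=> A /set2P[]->; rewrite ffunE ?in02 ?in1;
    apply/subsetP=> _ /imsetP[i + ->]; rewrite !inE.
    by case/orP=> /eqP->; rewrite fE.
  by move=> /eqP->; rewrite fE mem_pblock.
Qed.

(** The bound [m <= n] keeps the default [n] of the minimum from being below [m], so a smaller
    minimum comes from an element. *)
Lemma block_min_lt (n m : nat) (B : {set 'I_n}) : m <= n ->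
  (block_min B < m) = [exists j in B, j < m].
Proof.
move=> le_mn; apply/idP/exists_inP => [|[j jB]].
  rewrite ltnNge => /negP min_lt; apply/exists_inP; apply: contraT => /exists_inPn ge_m.
  case: min_lt; rewrite /block_min; elim/big_ind: _ => // [x y|j /ge_m].
    by rewrite leq_min => -> ->.
  by rewrite -leqNgt.
apply: leq_ltn_trans; rewrite /block_min.
have := mem_index_enum j; elim: (index_enum _) => //= k r IHr.
rewrite inE big_cons => /predU1P[<-|/IHr min_j]; first by rewrite jB geq_minl.
by case: ifP => // _; rewrite geq_min min_j orbT.
Qed.

Lemma block_min_eq (n : nat) (B : {set 'I_n}) (i : 'I_n) :
  i \in B -> (forall j, j \in B -> i <= j) -> block_min B = i.
Proof.
move=> iB min_i; apply/eqP; rewrite eqn_leq -ltnS block_min_lt //.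
rewrite [i <= _]leqNgt block_min_lt ?(ltnW (ltn_ord i)) //.
apply/andP; split; first by apply/exists_inP; exists i.
by apply/exists_inPn=> j /min_i; rewrite -leqNgt.
Qed.

(** * The partition into orbits of an involution, and its statistics *)

Definition pair_blocks (n : nat) (s : 'I_n -> 'I_n) : {set {set 'I_n}} :=
  [set [set i; s i] | i : 'I_n].

Section PairBlocks.

Variables (n : nat) (s : 'I_n -> 'I_n).
Hypothesis sK : involutive s.
Local Notation P := (pair_blocks s).

Lemma pair_eq (i j : 'I_n) : j \in [set i; s i] -> [set j; s j] = [set i; s i].
Proof. by case/set2P=> ->; rewrite // sK setUC. Qed.

Lemma partition_pair_blocks : partition P [set: 'I_n].
Proof.
apply/and3P; split.
- apply/eqP/setP=> i; rewrite inE; apply/bigcupP; exists [set i; s i].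
    exact: imset_f.
  by rewrite set21.
- apply/trivIsetP=> _ _ /imsetP[i _ ->] /imsetP[j _ ->].
  apply: contraNT => /pred0Pn[k /andP[/pair_eq <- /pair_eq <-]]; exact: eqxx.
- by apply/imsetP=> -[i _] /setP/(_ i); rewrite !inE eqxx.
Qed.

Lemma pblock_pair_blocks (i : 'I_n) : pblock P i = [set i; s i].
Proof.
have /and3P[_ triP _] := partition_pair_blocks.
by apply: (def_pblock triP); rewrite ?set21 //; apply: imset_f.
Qed.

(** Indexing each block by its smaller element makes the enumeration injective, so that blocks can
    be counted through indices. *)
Lemma pair_blocksE : P = [set [set i; s i] | i in [set i : 'I_n | i <= s i]].
Proof.
apply/eqP; rewrite eqEsubset; apply/andP; split; last first.
  by apply/subsetP=> _ /imsetP[i _ ->]; apply: imset_f.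
apply/subsetP=> _ /imsetP[i _ ->]; have [le_i|/ltnW le_i] := leqP i (s i).
  by apply/imsetP; exists i; rewrite ?inE.
by apply/imsetP; exists (s i); rewrite ?inE sK // setUC.
Qed.

Lemma pair_inj (i j : 'I_n) :
  i <= s i -> j <= s j -> [set i; s i] = [set j; s j] -> i = j.
Proof.
move=> le_i le_j /setP eq_ij; have := eq_ij i; rewrite set21 => /esym/set2P[//|eq_i].
by apply: val_inj => /=; move: le_i le_j; rewrite eq_i sK; lia.
Qed.

Lemma num_blocks_pairs (k : nat) :
  num_blocks k P = #|[set i : 'I_n | (i <= s i) && ((i != s i).+1 == k)]|.
Proof.
rewrite /num_blocks pair_blocksE -[RHS](@card_in_imset _ _ (fun i => [set i; s i])).
  apply: eq_card => B; rewrite inE; apply/andP/imsetP.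
    case=> /imsetP[i]; rewrite inE => le_i -> /eqP <-.
    by exists i; rewrite // inE le_i cards2 eqxx.
  case=> i; rewrite inE => /andP[le_i /eqP <-] ->.
  by rewrite cards2; split=> //; apply: imset_f; rewrite inE.
by move=> i j; rewrite !inE => /andP[le_i _] /andP[le_j _]; apply: pair_inj.
Qed.

Lemma num_blocks1 : num_blocks 1 P = #|[set i : 'I_n | s i == i]|.
Proof.
rewrite num_blocks_pairs; apply: eq_card => i; rewrite !inE eq_sym.
by case: (eqVneq (s i) i) => [->|_]; rewrite ?leqnn ?andbF.
Qed.

Hypothesis s_near : near_id s.

Lemma num_blocks2 : num_blocks 2 P = #|[set i : 'I_n | s i == i.+1 :> nat]|.
Proof.
rewrite num_blocks_pairs; apply: eq_card => i; rewrite !inE -val_eqE /=.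
by have [_ ?] := s_near i; lia.
Qed.

Lemma pair_blocks_avoid : P \in part_avoiders n.
Proof.
apply/part_avoidersP; split; first exact: partition_pair_blocks.
move=> _ a b /imsetP[i _ ->] /set2P[]-> /set2P[]->; have := s_near i; lia.
Qed.

(* A block {i, s i} with i <= s i forms a right bigger pair with b exactly when
   b < i: the block of b is an interval of length at most 2. *)
Lemma rb_pairs : rb P = \sum_(i : 'I_n | i <= s i) i.
Proof.
pose A := [set ib : 'I_n * 'I_n | (ib.1 <= s ib.1) && (ib.2 < ib.1)].
pose h (ib : 'I_n * 'I_n) := (ib.2, [set ib.1; s ib.1]).
have h_inj : {in A &, injective h}.
  move=> [i b] [j c]; rewrite !inE /= => /andP[le_i _] /andP[le_j _] [-> eq_ij].
  by rewrite (pair_inj le_i le_j eq_ij).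
have min_pair (i : 'I_n) : i <= s i -> block_min [set i; s i] = i.
  by move=> le_i; apply: block_min_eq; rewrite ?set21 // => j /set2P[]->.
transitivity #|h @: A|.
  apply: eq_card => -[b B]; rewrite inE pblock_pair_blocks; apply/and3P/imsetP.
    rewrite /= {1}pair_blocksE => -[/imsetP[i + ->]]; rewrite inE => le_i.
    rewrite (min_pair i) // block_min_lt ?(ltnW (ltn_ord i)) //.
    move=> /exists_inP[j /set2P jb lt_ji] _.
    exists (i, b) => //; rewrite inE /= le_i ltnNge; apply/negP => le_ib.
    (* If [i <= b], the witness below [i] must be [s b], and s(b) < i <= b <= s(b) + 1 forces b = i,
       against [i <= s i]. *)
    have eq_ib : i = b.
      by apply: val_inj => /=; have := s_near b; case: jb lt_ji => ->; lia.
    by case: jb lt_ji => ->; rewrite -eq_ib ltnNge ?leqnn ?le_i.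
  case=> -[i c]; rewrite inE /= => /andP[le_i lt_ci] [-> ->].
  split; first exact: imset_f.
    rewrite (min_pair i) // block_min_lt ?(ltnW (ltn_ord i)) //.
    by apply/exists_inP; exists c; rewrite ?set21.
  apply: leq_trans lt_ci _; apply: leq_bigmax_cond; exact: set21.
rewrite card_in_imset // -sum1dep_card.
rewrite -(pair_big_dep (fun i : 'I_n => i <= s i) (fun i b : 'I_n => b < i)
                       (fun _ _ => 1)) /=.
by apply: eq_bigr => i _; rewrite sum1dep_card card_ord_lt // ltnW.
Qed.

End PairBlocks.

(** * The correspondence between involutions and partitions, and the equality of the polynomials *)

Lemma pair_blocks_inj (n : nat) (s t : 'I_n -> 'I_n) :
  involutive s -> involutive t -> pair_blocks s = pair_blocks t -> s =1 t.
Proof.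
move=> sK tK eq_st i.
have /setP eq_i : [set i; s i] = [set i; t i].
  by rewrite -!pblock_pair_blocks // eq_st.
have /set2P[si|//] : s i \in [set i; t i] by rewrite -eq_i set22.
by have /set2P[->|->] : t i \in [set i; s i] by rewrite eq_i set22.
Qed.

Lemma part_avoiders_pairs (n : nat) (P : {set {set 'I_n}}) :
  P \in part_avoiders n ->
  exists s : 'I_n -> 'I_n, [/\ involutive s, near_id s & P = pair_blocks s].
Proof.
case/part_avoidersP=> /and3P[/eqP coverP triP P0] near.
have cP i : i \in cover P by rewrite coverP inE.
have self_b i : i \in pblock P i by rewrite mem_pblock.
have near_b i j : j \in pblock P i -> (i <= j.+1) && (j <= i.+1).
  have iP := pblock_mem (cP i) => ji.
  by rewrite !(near _ _ _ iP) ?self_b.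
(* The other element of the block of [i], with [i] itself as default for a singleton block. *)
pose s i := odflt i [pick j in pblock P i | j != i].
have s_in i : s i \in pblock P i.
  by rewrite /s; case: pickP => [j /andP[]|_] //=; rewrite self_b.
have sE i : pblock P i = [set i; s i].
  apply/setP=> k; rewrite in_set2.
  have [->|ne_ki] := eqVneq k i; first by rewrite self_b.
  rewrite /s; case: pickP => [j /andP[ji ne_ji] | /(_ k)] /=; last first.
    by rewrite ne_ki andbT (negPf ne_ki).
  apply/idP/eqP => [ki|->] //; apply: val_inj => /=.
  (* Three distinct integers cannot be pairwise at distance at most 1, so [k] and [j] coincide. *)
  have jk : j \in pblock P k by rewrite (same_pblock triP ki).
  have := near_b _ _ ki; have := near_b _ _ ji; have := near_b _ _ jk.
  by move: ne_ki ne_ji; rewrite -!val_eqE /=; lia.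
exists s; split=> [i|i|].
- have : i \in [set s i; s (s i)] by rewrite -sE (same_pblock triP (s_in i)) self_b.
  case/set2P=> // si.
  by rewrite -!si.
- by have /andP[] := near_b _ _ (s_in i).
apply/setP=> B; apply/idP/imsetP => [BP|[i _ ->]]; last by rewrite -sE pblock_mem.
have /set0Pn[i iB] : B != set0 by apply: contraNneq P0 => <-.
by exists i; rewrite // -sE (def_pblock triP BP iB).
Qed.

Theorem theorem3p1 (n : nat) : FM n = FP n.
Proof.
pose h (pi : 'S_n) := pair_blocks (flip pi).
have flipK (pi : 'S_n) : pi \in perm_avoiders n -> involutive (flip pi).
  by move/perm_avoidersP; apply: near_id_involutive (@flip_inj n pi).
have h_inj : {in perm_avoiders n &, injective h}.
  move=> pi rho /flipK piK /flipK rhoK /(pair_blocks_inj piK rhoK) eq_flip.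
  by apply/permP=> i; apply: rev_ord_inj; apply: eq_flip.
have h_onto : part_avoiders n = h @: perm_avoiders n.
  apply/setP=> P; apply/idP/imsetP => [/part_avoiders_pairs[s [sK s_near ->]]|].
    (* Value reversal undoes itself, so reversing the values of [s] gives the preimage. *)
    have rs_inj : injective (fun i => rev_ord (s i)).
      exact: inj_comp rev_ord_inj (inv_inj sK).
    have flip_s : flip (perm rs_inj) =1 s by move=> i; rewrite /flip permE rev_ordK.
    exists (perm rs_inj).
      by apply/perm_avoidersP=> i; rewrite flip_s; apply: s_near.
    by rewrite /h /pair_blocks; apply: eq_imset => i; rewrite flip_s.
  case=> pi pi_av ->; apply: pair_blocks_avoid (flipK _ pi_av) _.
  exact/perm_avoidersP.
rewrite /FM /FP h_onto big_imset //=; apply: eq_bigr => pi pi_av.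
have s_near := perm_avoidersP _ pi_av; have s_inj := @flip_inj n pi.
have s_lt := flip_lt pi; have sK := flipK _ pi_av.
rewrite (num_runs1 s_inj s_near s_lt) (num_runs2 s_inj s_near s_lt).
rewrite (majE s_inj s_near s_lt).
by rewrite num_blocks1 // num_blocks2 // rb_pairs.
Qed.
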